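(* Let $c \in \mathbb{R}^n$, let $Q$ be a real symmetric $n \times n$ matrix, let $\sigma > 0$, and let $m(s) = c^T s + \frac12 s^T Q s + \frac13 \sigma \|s\|^3$ for $s \in \mathbb{R}^n$. Let $\bar s \in \mathbb{R}^n$ be a stationary point of $m$. Then $\bar s$ is not a global minimizer of $m$ over $\mathbb{R}^n$ if and only if at least one of the following two conditions holds: (a) $c^T \bar s > 0$; (b) $c^T \bar s \le 0$ and there exists a vector $d \in \mathbb{R}^n$ such that $d^T (Q + \sigma \|\bar s\| I) d < 0$.
   Context: $\|\cdot\|$ is the Euclidean norm and $I$ is the $n \times n$ identity matrix. A point $s^* \in \mathbb{R}^n$ is called a stationary point of $m$ if $\nabla m(s^* ) = c + Q s^* + \sigma \|s^*\| s^* = 0$; equivalently, $c + Q s^* + \lambda s^* = 0$ with $\lambda = \sigma \|s^*\|$. *)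

(* Defs.v *)
From mathcomp Require Import all_boot all_order all_algebra.
From mathcomp Require Import all_classical all_reals all_analysis.
From mathcomp Require Import ring lra.

Set Implicit Arguments.
Unset Strict Implicit.
Unset Printing Implicit Defensive.

Import Order.TTheory GRing.Theory Num.Theory.
Import numFieldNormedType.Exports.

Local Open Scope ring_scope.

Definition dotv (R : realType) (n : nat) (u v : 'cV[R]_n) : R :=
  (u^T *m v) 0 0.

(* The library's norm `|s| on matrices is the sup norm; it induces the same
   topology and hence the same derivatives, but the cubic term of the model
   needs the Euclidean norm. *)
Definition enorm (R : realType) (n : nat) (s : 'cV[R]_n) : R :=
  Num.sqrt (dotv s s).

Definition cubic_model (R : realType) (n : nat)
    (c : 'cV[R]_n) (Q : 'M[R]_n) (sigma : R) (s : 'cV[R]_n) : R :=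
  dotv c s + 2^-1 * dotv s (Q *m s) + 3^-1 * sigma * enorm s ^+ 3.

(* 'D_v f s is a total operator, meaningful only when f is derivable at s
   along v; by is_derive_cubic_model this always holds for the cubic model,
   and gradient_cubic_model gives grad m(s) = c + Q s + sigma |s| s. *)
Definition gradient (R : realType) (n : nat) (f : 'cV[R]_n -> R)
    (s : 'cV[R]_n) : 'cV[R]_n :=
  \col_i 'D_(delta_mx i 0) f s.

Definition stationary_point (R : realType) (n : nat) (f : 'cV[R]_n -> R)
    (s : 'cV[R]_n) : Prop :=
  gradient f s = 0.

Definition global_minimizer (R : realType) (n : nat) (f : 'cV[R]_n -> R)
    (s : 'cV[R]_n) : Prop :=
  forall t : 'cV[R]_n, f s <= f t.

Local Open Scope classical_set_scope.

Section dotv_theory.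
Variables (R : realType) (n : nat).
Implicit Types u v w s : 'cV[R]_n.

Lemma dotvE u v : dotv u v = \sum_i u i 0 * v i 0.
Proof. by rewrite /dotv mxE; apply: eq_bigr => i _; rewrite mxE. Qed.

Lemma dotvC u v : dotv u v = dotv v u.
Proof. by rewrite !dotvE; apply: eq_bigr => i _; rewrite mulrC. Qed.

Lemma dotvDr u v w : dotv u (v + w) = dotv u v + dotv u w.
Proof. by rewrite /dotv mulmxDr mxE. Qed.

Lemma dotvZr a u v : dotv u (a *: v) = a * dotv u v.
Proof. by rewrite /dotv -scalemxAr mxE. Qed.

Lemma dotvDl u v w : dotv (v + w) u = dotv v u + dotv w u.
Proof. by rewrite !(dotvC _ u) dotvDr. Qed.

Lemma dotvZl a u v : dotv (a *: v) u = a * dotv v u.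
Proof. by rewrite !(dotvC _ u) dotvZr. Qed.

Lemma dotv_ge0 u : 0 <= dotv u u.
Proof. by rewrite dotvE; apply: sumr_ge0 => i _; rewrite -expr2 sqr_ge0. Qed.

Lemma dotv_mulmx_sym (Q : 'M[R]_n) u v : Q^T = Q ->
  dotv u (Q *m v) = dotv v (Q *m u).
Proof.
by move=> Qs; rewrite dotvC /dotv trmx_mul Qs mulmxA.
Qed.

Lemma enorm_ge0 u : 0 <= enorm u. Proof. exact: sqrtr_ge0. Qed.

Lemma sqr_enorm u : enorm u ^+ 2 = dotv u u.
Proof. exact/sqr_sqrtr/dotv_ge0. Qed.

Lemma dotv_le_enorm u v : dotv u v <= enorm u * enorm v.
Proof.
have [x0|x0] := eqVneq (dotv v v) 0.
  have -> : v = 0.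
    apply/colP => i; rewrite mxE; apply/eqP; rewrite -sqrf_eq0 expr2.
    move: x0; rewrite dotvE => /psumr_eq0P -> // j _.
    by rewrite -expr2 sqr_ge0.
  by rewrite -(scale0r 0) dotvZr mul0r mulr_ge0// enorm_ge0.
have vgt0 : 0 < dotv v v by rewrite lt_neqAle eq_sym x0 dotv_ge0.
apply: (le_trans (ler_norm _)).
rewrite -(ler_pXn2r (n := 2)) ?nnegrE ?mulr_ge0 ?enorm_ge0//.
rewrite real_normK ?num_real// exprMn !sqr_enorm.
have := dotv_ge0 (dotv v v *: u + - dotv u v *: v).
rewrite !(dotvDl, dotvDr, dotvZl, dotvZr) (dotvC v u) => H.
rewrite -subr_ge0 -(pmulr_rge0 _ vgt0); apply: le_trans H _.
by rewrite le_eqVlt; apply/orP; left; apply/eqP; ring.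
Qed.

End dotv_theory.

Lemma is_derive_cubic_model (R : realType) (n : nat) (c : 'cV[R]_n)
    (Q : 'M[R]_n) (sigma : R) (s v : 'cV[R]_n) : Q^T = Q ->
  is_derive s v (cubic_model c Q sigma)
    (dotv (c + Q *m s + (sigma * enorm s) *: s) v).
Proof.
move=> Qsym; set L := dotv _ v; set m := cubic_model c Q sigma.
set b := enorm s; set vv := dotv v v; set nv := enorm v.
have b0 : 0 <= b := enorm_ge0 s.
have nv0 : 0 <= nv := enorm_ge0 v.
have vv0 : 0 <= vv := dotv_ge0 v.
pose K := `|dotv v (Q *m v)| + `|sigma| * (2 * b * vv + vv * nv).
have K0 : 0 <= K by rewrite addr_ge0 ?mulr_ge0 ?addr_ge0 ?mulr_ge0.
have bnd h : h != 0 -> `|h| <= 1 ->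
    `|L - h^-1 *: (m (h *: v + s) - m s)| <= K * `|h|.
  move=> h0 h1; set a := enorm (h *: v + s).
  have a0 : 0 <= a := enorm_ge0 _.
  have a2 : a ^+ 2 = h ^+ 2 * vv + 2 * h * dotv s v + b ^+ 2.
    rewrite /a /b !sqr_enorm !(dotvDl, dotvDr, dotvZl, dotvZr) (dotvC v s) /vv.
    ring.
  have ab2 : (a - b) ^+ 2 <= h ^+ 2 * vv.
    have := dotv_le_enorm s (h *: v + s).
    rewrite dotvDr dotvZr -sqr_enorm -/a -/b => cs.
    have -> : (a - b) ^+ 2 = a ^+ 2 + b ^+ 2 - 2 * (b * a) by ring.
    by rewrite a2; nra.
  have ale : a <= b + `|h| * nv.
    have : `|a - b| <= `|h| * nv.
      rewrite -(ler_pXn2r (n := 2)) ?nnegrE ?mulr_ge0//.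
      by rewrite real_normK ?num_real// exprMn sqr_enorm real_normK ?num_real.
    by move=> /(le_trans (ler_norm _)); lra.
  have -> : L - h^-1 *: (m (h *: v + s) - m s) =
     - (h / 2 * dotv v (Q *m v)
      + sigma / 3 * (3 / 2 * b * h * vv + h^-1 * ((a - b) ^+ 2 * (a + b / 2)))).
    rewrite /m /cubic_model -/a -/b /L mulmxDr -scalemxAr.
    rewrite !(dotvDl, dotvDr, dotvZl, dotvZr) -/b.
    rewrite [dotv (Q *m s) v]dotvC [dotv s (Q *m v)](dotv_mulmx_sym _ _ Qsym).
    have -> : (a - b) ^+ 2 * (a + b / 2) =
        a ^+ 3 - b ^+ 3 - 3 / 2 * b * (a ^+ 2 - b ^+ 2) by field.
    rewrite a2 /GRing.scale /=; field.
    exact: h0.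
  rewrite normrN [K * _]mulrDl; apply: (le_trans (ler_normD _ _)); apply: lerD.
    rewrite !normrM mulrC ler_wpM2l// [`|2^-1|]ger0_norm ?invr_ge0//.
    by have := normr_ge0 h; lra.
  rewrite normrM [`|sigma / 3|]normrM [`|3^-1|]ger0_norm ?invr_ge0//.
  rewrite -[_ * 3^-1 * _]mulrA -[_ * _ * `|h|]mulrA; apply: ler_wpM2l => //.
  have H : `|3 / 2 * b * h * vv + h^-1 * ((a - b) ^+ 2 * (a + b / 2))| <=
      3 / 2 * b * vv * `|h| + vv * (3 / 2 * b + nv) * `|h|.
    apply: (le_trans (ler_normD _ _)); apply: lerD.
      have -> : 3 / 2 * b * h * vv = (3 / 2 * b * vv) * h by ring.
      by rewrite normrM ger0_norm// !mulr_ge0 ?invr_ge0.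
    rewrite normrM normfV mulrC ler_pdivrMr ?normr_gt0//.
    rewrite ger0_norm; last by rewrite mulr_ge0 ?sqr_ge0// addr_ge0 ?divr_ge0.
    have -> : vv * (3 / 2 * b + nv) * `|h| * `|h| =
        (h ^+ 2 * vv) * (3 / 2 * b + nv).
      by rewrite -(real_normK (num_real h)); ring.
    apply: ler_pM; rewrite ?sqr_ge0 ?addr_ge0 ?divr_ge0//.
    by have := ler_piMl nv0 h1; lra.
  have := mulr_ge0 (mulr_ge0 vv0 nv0) (normr_ge0 h).
  have := mulr_ge0 (mulr_ge0 b0 vv0) (normr_ge0 h).
  lra.
have lim : (fun h => h^-1 *: (m (h *: v + s) - m s)) @ 0^' --> L.
  apply/cvgrPdist_lt => e e0.
  near=> h.
  have h0 : h != 0 by near: h; exact: nbhs_dnbhs_neq.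
  have hK : `|h| < e / (K + 1).
    near: h; apply: dnbhs0_lt; rewrite divr_gt0//; lra.
  have h1 : `|h| <= 1 by near: h; apply: dnbhs0_le.
  apply: (le_lt_trans (bnd _ h0 h1)).
  move: hK; rewrite ltr_pdivlMr; last lra.
  have := normr_ge0 h; lra.
by apply: DeriveDef; [apply/cvg_ex; exists L|apply: cvg_lim].
Unshelve. all: by end_near.
Qed.

Lemma gradient_cubic_model (R : realType) (n : nat) (c : 'cV[R]_n)
    (Q : 'M[R]_n) (sigma : R) (s : 'cV[R]_n) : Q^T = Q ->
  gradient (cubic_model c Q sigma) s = c + Q *m s + (sigma * enorm s) *: s.
Proof.
move=> Qsym; apply/colP => i; rewrite mxE.
rewrite (derive_val (is_derive := is_derive_cubic_model c sigma s _ Qsym)).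
rewrite dotvE (bigD1 i)//= big1 ?addr0 => [|j ji].
  by rewrite [delta_mx _ _ _ _]mxE !eqxx mulr1.
by rewrite [delta_mx _ _ _ _]mxE (negbTE ji) mulr0.
Qed.

(* Main.v *)
Require Import Defs.
From mathcomp Require Import all_boot all_order all_algebra.
From mathcomp Require Import all_classical all_reals all_analysis.
From mathcomp Require Import ring lra.

Import Order.TTheory GRing.Theory Num.Theory.

Local Open Scope ring_scope.

(** With H = Q + sigma |s| I, stationarity reads c = - H s, and completing the
    square gives the exact expansion
      m(t) - m(s) = (t - s)^T H (t - s) / 2
                    + sigma (|t| - |s|)^2 (2 |t| + |s|) / 6.
    Hence s is a global minimizer if H is positive semidefinite. Conversely,
    let d^T H d < 0. If d is not orthogonal to s, reflecting s across the
    hyperplane orthogonal to d keeps the norm and decreases m. If d is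
    orthogonal to s <> 0, then d + e s is not, and it is still a direction of
    negative curvature for a small e of suitable sign. If s = 0, a small step
    along d decreases m. Finally c^T s = - s^T H s, so (a) already provides a
    direction of negative curvature. *)

(** A negative leading coefficient survives a small first-order perturbation; the bound [e <= 1]
    later gives [e ^+ 2 <= e]. *)
Lemma exists_small_step {R : realFieldType} (A C : R) : A < 0 ->
  exists e, [/\ 0 < e, e <= 1 & A + C * e < 0].
Proof.
move=> A0; have D0 : 0 < `|C| - A by have := normr_ge0 C; lra.
exists (- A / (`|C| - A)); split; first by rewrite divr_gt0 ?oppr_gt0.
  by rewrite ler_pdivrMr // mul1r; have := normr_ge0 C; lra.
have -> : A + C * (- A / (`|C| - A)) = - A * (C - `|C| + A) / (`|C| - A).
  by field; rewrite gt_eqF.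
rewrite pmulr_llt0 ?invr_gt0 // pmulr_rlt0 ?oppr_gt0 //.
by have := ler_norm C; lra.
Qed.

Section CubicModel.
Context {R : realType} {n : nat}.
Implicit Types (c s t d w : 'cV[R]_n) (Q H : 'M[R]_n) (sigma : R).

Lemma dotv_shift_scalar Q (a : R) s t :
  dotv s ((Q + a *: 1%:M) *m t) = dotv s (Q *m t) + a * dotv s t.
Proof. by rewrite mulmxDl dotvDr -scalemxAl mul1mx dotvZr. Qed.

Lemma dotv_gt0 d : d != 0 -> 0 < dotv d d.
Proof.
rewrite lt_def dotv_ge0 andbT; apply: contra_neq => d0.
apply/colP => i; rewrite mxE; apply/eqP; rewrite -sqrf_eq0 expr2; apply/eqP.
move: d0; rewrite dotvE => /psumr_eq0P -> // j _.
by rewrite -expr2 sqr_ge0.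
Qed.

Lemma dotv0 s : dotv s 0 = 0.
Proof. by rewrite /dotv mulmx0 mxE. Qed.

Lemma stationary_pointP c Q sigma s : Q^T = Q ->
  stationary_point (cubic_model c Q sigma) s <->
  c = - ((Q + (sigma * enorm s) *: 1%:M) *m s).
Proof.
move=> Qsym; rewrite /stationary_point gradient_cubic_model // mulmxDl.
rewrite -scalemxAl mul1mx -addrA; split=> [/eqP|->]; last by rewrite addNr.
by rewrite addr_eq0 => /eqP.
Qed.

Lemma cubic_model_expansion c Q sigma s w : Q^T = Q ->
  stationary_point (cubic_model c Q sigma) s ->
  cubic_model c Q sigma (s + w) - cubic_model c Q sigma s =
  2^-1 * dotv w ((Q + (sigma * enorm s) *: 1%:M) *m w) +
  6^-1 * sigma * ((enorm (s + w) - enorm s) ^+ 2 *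
                  (2 * enorm (s + w) + enorm s)).
Proof.
move=> Qsym /(stationary_pointP _ _ _ _ Qsym) cE.
have cdot t : dotv c t = - (dotv t (Q *m s) + sigma * enorm s * dotv t s).
  by rewrite cE -scaleN1r dotvZl mulN1r dotvC dotv_shift_scalar.
have ss := sqr_enorm s.
have := sqr_enorm (s + w).
rewrite !(dotvDl, dotvDr) (dotvC s w) -ss => sw.
rewrite /cubic_model !dotvDr !mulmxDr !cdot dotv_shift_scalar.
rewrite !(dotvDl, dotvDr) (dotv_mulmx_sym s w Qsym) -ss.
(* With |w|^2 eliminated, the claim is a polynomial identity in the two norms and the remaining
   products. *)
have -> : dotv w w = enorm (s + w) ^+ 2 - enorm s ^+ 2 - 2 * dotv w s.
  by rewrite sw; ring.
by field.
Qed.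

Lemma global_minimizer_of_psd c Q sigma s : Q^T = Q -> 0 < sigma ->
  stationary_point (cubic_model c Q sigma) s ->
  (forall d, 0 <= dotv d ((Q + (sigma * enorm s) *: 1%:M) *m d)) ->
  global_minimizer (cubic_model c Q sigma) s.
Proof.
move=> Qsym sigma0 stat psd t.
rewrite -(subrKC s t) -subr_ge0 cubic_model_expansion //.
have a0 := enorm_ge0 s; have b0 := enorm_ge0 (s + (t - s)).
apply: addr_ge0; first by rewrite mulr_ge0 // invr_ge0.
apply: mulr_ge0; first by rewrite mulr_ge0 ?invr_ge0 // ltW.
by rewrite mulr_ge0 ?sqr_ge0 // addr_ge0 // mulr_ge0.
Qed.

Lemma global_minimizer_curvature_nonorth c Q sigma s d : Q^T = Q ->
  stationary_point (cubic_model c Q sigma) s ->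
  global_minimizer (cubic_model c Q sigma) s -> dotv d s != 0 ->
  0 <= dotv d ((Q + (sigma * enorm s) *: 1%:M) *m d).
Proof.
move=> Qsym stat smin ds.
have dd : 0 < dotv d d.
  by apply: dotv_gt0; apply: contra_neq ds => ->; rewrite dotvC dotv0.
(* [s + x *: d] is the mirror image of [s] across the hyperplane orthogonal to [d]. *)
pose x := - 2 * dotv d s / dotv d d.
have x0 : x != 0.
  by rewrite /x !mulf_neq0 ?oppr_eq0 ?pnatr_eq0 // invr_eq0 gt_eqF.
have nE : enorm (s + x *: d) = enorm s.
  rewrite /enorm; congr Num.sqrt.
  rewrite !(dotvDl, dotvDr, dotvZl, dotvZr) (dotvC s d) /x.
  by field; rewrite gt_eqF.
(* Equal norms kill the cubic remainder, leaving x^2 d^T H d / 2 >= 0. *)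
have := smin (s + x *: d); rewrite -subr_ge0 cubic_model_expansion // nE.
rewrite subrr expr0n /= mul0r mulr0 addr0 -scalemxAr dotvZr dotvZl.
rewrite pmulr_rge0 ?invr_gt0 // mulrA -expr2 pmulr_rge0 //.
by rewrite exprn_even_gt0.
Qed.

Lemma global_minimizer_curvature_zero c Q sigma d : Q^T = Q -> 0 < sigma ->
  stationary_point (cubic_model c Q sigma) 0 ->
  global_minimizer (cubic_model c Q sigma) 0 ->
  0 <= dotv d ((Q + (sigma * enorm (0 : 'cV[R]_n)) *: 1%:M) *m d).
Proof.
move=> Qsym sigma0 stat smin; rewrite leNgt; apply/negP => A0.
(* The slope comes from m(e d) - m(0) = (e^2 / 2) (d^T H d + (2/3) sigma |d|^3 e). *)
have [e [e0 _ small]] := exists_small_step _ (3^-1 * 2 * sigma * enorm d ^+ 3) A0.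
have := smin (0 + e *: d); rewrite -subr_ge0 cubic_model_expansion // add0r.
rewrite -scalemxAr dotvZr dotvZl.
have n0 : enorm (0 : 'cV[R]_n) = 0 by rewrite /enorm dotv0 sqrtr0.
have nE : enorm (e *: d) = e * enorm d.
  rewrite /enorm dotvZl dotvZr mulrA -expr2 sqrtrM ?sqr_ge0 //.
  by rewrite sqrtr_sqr gtr0_norm.
move: small; rewrite nE n0; set A := dotv _ _ => small.
have -> : 2^-1 * (e * (e * A)) +
    6^-1 * sigma * ((e * enorm d - 0) ^+ 2 * (2 * (e * enorm d) + 0)) =
    2^-1 * e ^+ 2 * (A + 3^-1 * 2 * sigma * enorm d ^+ 3 * e) by field.
by rewrite pmulr_rge0 ?mulr_gt0 ?invr_gt0 ?exprn_gt0 // leNgt small.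
Qed.

Lemma global_minimizer_psd c Q sigma s d : Q^T = Q -> 0 < sigma ->
  stationary_point (cubic_model c Q sigma) s ->
  global_minimizer (cubic_model c Q sigma) s ->
  0 <= dotv d ((Q + (sigma * enorm s) *: 1%:M) *m d).
Proof.
move=> Qsym sigma0 stat smin.
have [s0|s0] := eqVneq s 0.
  by move: stat smin; rewrite s0; exact: global_minimizer_curvature_zero.
have [ds|] := eqVneq (dotv d s) 0; last first.
  exact: (@global_minimizer_curvature_nonorth c).
rewrite leNgt; apply/negP => A0.
set H := Q + _ in A0 *.
have ss := dotv_gt0 _ s0.
have [e [e0 e1]] := exists_small_step _ `|dotv s (H *m s)| A0.
(* Adding the curvatures along d + e s and d - e s cancels the cross terms. *)
have curv x : x != 0 -> 0 <= dotv (d + x *: s) (H *m (d + x *: s)).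
  move=> x0; apply: (@global_minimizer_curvature_nonorth c) => //.
  by rewrite dotvDl dotvZl ds add0r mulf_neq0 // gt_eqF.
have := curv e; have := curv (- e).
rewrite oppr_eq0 gt_eqF // => /(_ isT) + /(_ isT).
rewrite !mulmxDr -!scalemxAr !(dotvDl, dotvDr, dotvZl, dotvZr).
set A := dotv d (H *m d); set C := dotv s (H *m s).
have := ler_norm C; have := normr_ge0 C.
set B := dotv d _; set B' := dotv s _; set K := `|C| => K0 CK H1 H2 H3.
(* The two curvatures sum to 2 (A + C e^2), and C e^2 <= K e since e <= 1, against A + K e < 0. *)
have : C * e ^+ 2 <= K * e ^+ 2 by rewrite ler_wpM2r // sqr_ge0.
have : K * e ^+ 2 <= K * e by rewrite ler_wpM2l // expr2 ger_pMl.
lra.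
Qed.

End CubicModel.

Theorem mainTheorem2 (R : realType) (n : nat) (c : 'cV[R]_n) (Q : 'M[R]_n)
    (sigma : R) (sbar : 'cV[R]_n) (Qsym : Q^T = Q) (sigma_gt0 : 0 < sigma)
    (sbar_stat : stationary_point (cubic_model c Q sigma) sbar) :
  ~ global_minimizer (cubic_model c Q sigma) sbar <->
  (0 < dotv c sbar \/
   (dotv c sbar <= 0 /\
    exists d : 'cV[R]_n,
      dotv d ((Q + (sigma * enorm sbar) *: 1%:M) *m d) < 0)).
Proof.
have cE : c = - ((Q + (sigma * enorm sbar) *: 1%:M) *m sbar).
  by apply/stationary_pointP.
split=> [nmin|].
  have [cs|cs] := ltP 0 (dotv c sbar); first by left.
  (* If no such [d] exists, H is positive semidefinite. *)
  right; split=> //; apply: contrapT => nex; apply: nmin.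
  apply: global_minimizer_of_psd => // d.
  by rewrite leNgt; apply/negP => dneg; apply: nex; exists d.
move=> neg smin.
have psd d := global_minimizer_psd _ _ _ _ d Qsym sigma_gt0 sbar_stat smin.
case: neg => [|[_ [d]]]; last by rewrite ltNge psd.
(* In case (a), [sbar] itself is the direction of negative curvature. *)
by rewrite cE -scaleN1r dotvZl mulN1r dotvC oppr_gt0 ltNge psd.
Qed.
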